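(* Let $k\ge 1$ be an odd square-free integer with $\gcd(k,5)=1$, and let $K_k=\mathbb{Q}\big(\sqrt{k(5+\sqrt5)}\big)$. Then \[ \tfrac{1}{1920}\, D_{K_k}^{1/2} \le M(\mathcal{O}_{K_k}) \le D_{K_k}^{1/2}. \]
   Context: For a nonconstant polynomial $f(x)=c\prod_{i=1}^d (x-\alpha_i)\in\mathbb{C}[x]$, the Mahler measure is $M(f)=|c|\prod_{|\alpha_i|\ge 1}|\alpha_i|$. For an algebraic number $\alpha$, $M(\alpha)$ is the Mahler measure of its minimal polynomial over $\mathbb{Z}$ (with content $1$). For a number field $K$ with ring of integers $\mathcal{O}_K$ and absolute discriminant $D_K$, $M(\mathcal{O}_K)=\min\{M(\alpha):\alpha\in\mathcal{O}_K,\ \mathbb{Q}(\alpha)=K\}$. *)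

(* Defs.v *)
From HB Require Import structures.
From mathcomp Require Import all_boot all_order all_algebra all_field.
Set Implicit Arguments. Unset Strict Implicit. Unset Printing Implicit Defensive.
Import Order.TTheory GRing.Theory Num.Theory.
Local Open Scope ring_scope.

(* All number fields live inside algC (algebraic complex numbers).
   A number field is presented as Q(b) for a generator b : algC. *)

Definition squarefree (k : nat) : Prop :=
  forall p : nat, prime p -> ~~ (p * p %| k)%N.

Definition in_Qgen (b x : algC) : Prop :=
  exists p : {poly rat}, x = (map_poly ratr p).[b].

Definition in_OK (b x : algC) : Prop := in_Qgen b x /\ x \in Aint.

Definition same_field (b a : algC) : Prop := in_Qgen b a /\ in_Qgen a b.

Definition poly_mahler (f : {poly algC}) (m : algC) : Prop :=
  exists rs : seq algC,
    f = lead_coef f *: \prod_(r <- rs) ('X - r%:P) /\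
    m = `|lead_coef f| * \prod_(r <- rs | 1 <= `|r|) `|r|.

(* f is the minimal polynomial of a over Z with content 1
   (i.e. the least positive integer multiple of the monic rational
   minimal polynomial lying in Z[x]; unique up to sign). *)
Definition minZpoly (a : algC) (f : {poly algC}) : Prop :=
  exists c : nat, (0 < c)%N /\ f = c%:R *: minCpoly a /\
    f \is a polyOver Num.int /\
    forall d : nat, (0 < d < c)%N -> ~~ (d%:R *: minCpoly a \is a polyOver Num.int).

Definition alg_mahler (a m : algC) : Prop :=
  exists f, minZpoly a f /\ poly_mahler f m.

Definition is_mahler_OK (b m : algC) : Prop :=
  (exists a, in_OK b a /\ same_field b a /\ alg_mahler a m) /\
  forall a m', in_OK b a -> same_field b a -> alg_mahler a m' -> m <= m'.

(* D is the absolute discriminant |disc(K)| of K = Q(b):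
   rs lists the conjugates of b (so the embeddings of K are p(b) |-> p(rs i)),
   B j = (P j).[b] is a Z-basis of O_K, and
   D = |det (sigma_i (B j))|^2. *)
Definition abs_disc (b D : algC) : Prop :=
  exists (n : nat) (rs : 'I_n -> algC) (P : 'I_n -> {poly rat}),
    let B j := (map_poly ratr (P j)).[b] in
    minCpoly b = \prod_(i < n) ('X - (rs i)%:P) /\
    (forall j, B j \in Aint) /\
    (forall x, in_OK b x -> exists z : 'I_n -> int, x = \sum_j (z j)%:~R * B j) /\
    (forall z : 'I_n -> int, \sum_j (z j)%:~R * B j = 0 -> forall j, z j = 0) /\
    D = `| \det (\matrix_(i, j) (map_poly ratr (P j)).[rs i]) | ^+ 2.

(* Main.v *)
(* Write s = sqrt 5, omega = (1 + s) / 2 and b = sqrt (k (5 + s)), and let a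
   prime denote the replacement of s by - s.  The conjugates of b are b, b', - b
   and - b', since X^4 - 10 k X^2 + 20 k^2 is Eisenstein at 5, and b b' = 2 k s.

   Ring of integers: b^2 = 2 k s omega, where omega is a unit of Z[omega] and
   2 k s is squarefree there, because 2 k is squarefree and prime to 5, the only
   ramified prime.  If x + y b is integral with x, y in Q(s), then (2 y)^2 b^2,
   the square of the difference with the conjugate x - y b, is integral, hence
   so is 2 y.  Since the relative norm x^2 - y^2 b^2 is integral too,
   2 x^2 = 2 (x^2 - y^2 b^2) + (2 y)^2 k s omega is integral, hence so are x and
   then y.  So 1, omega, b, omega b is an integral basis, and the square root of
   the discriminant is 40 k s.

   Lower bound: if x + y b generates K, applying
   |u - v| <= 2 max(1, |u|) max(1, |v|) to x + y b, x - y b and to x' + y' b',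
   x' - y' b' bounds the Mahler measure below by |y y'| b b' >= 2 k s, since
   y y' is a nonzero integer.

   Upper bound: choose x in Z[omega] with |x - b|, |x' - b'| <= 5/4 <= b, b'.
   The conjugates x - b and x' - b' of x + b have size at most 5/4, the other
   two at most 3 b and 3 b', so the Mahler measure of x + b is at most
   9 (5/4)^2 b b' <= 40 k s. *)
Require Import Defs.
From HB Require Import structures.
From mathcomp Require Import all_boot all_order all_algebra all_field perm.
From mathcomp Require Import ring zify.
Set Implicit Arguments.
Unset Strict Implicit.
Unset Printing Implicit Defensive.
Import Order.TTheory GRing.Theory Num.Theory.
Local Open Scope ring_scope.

(** * Polynomial expressions in an algebraic number *)

Definition evalQ (x : algC) (p : {poly rat}) : algC := (map_poly ratr p).[x].

HB.instance Definition _ x :=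
  GRing.RMorphism.copy (evalQ x) (horner_eval x \o map_poly ratr).

Lemma evalQX x : evalQ x 'X = x.
Proof. by rewrite /evalQ map_polyX hornerX. Qed.

Lemma evalQC x a : evalQ x a%:P = ratr a.
Proof. by rewrite /evalQ map_polyC hornerC. Qed.

Lemma evalQZ x a p : evalQ x (a *: p) = ratr a * evalQ x p.
Proof. by rewrite -mul_polyC rmorphM /= evalQC. Qed.

Lemma evalQ_comp x p q : evalQ x (p \Po q) = evalQ (evalQ x q) p.
Proof. by rewrite /evalQ map_comp_poly horner_comp. Qed.

Lemma evalQ_ratr a p : evalQ (ratr a) p = ratr p.[a].
Proof. exact: horner_map. Qed.

Lemma evalQ_even_odd x p :
  evalQ x p = evalQ (x ^+ 2) (even_poly p) + evalQ (x ^+ 2) (odd_poly p) * x.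
Proof.
rewrite -{1}[p]poly_even_odd rmorphD rmorphM /= !evalQ_comp.
by rewrite rmorphXn /= evalQX.
Qed.

Lemma evalQ_modp x f p : evalQ x f = 0 -> evalQ x (p %% f) = evalQ x p.
Proof.
move=> fx.
by rewrite [in RHS](divp_eq p f) rmorphD rmorphM /= fx mulr0 add0r.
Qed.

Lemma evalQ_int_comb n x (P : 'I_n -> {poly rat}) (z : 'I_n -> int) :
  evalQ x (\sum_j (z j)%:~R *: P j) = \sum_j (z j)%:~R * evalQ x (P j).
Proof.
by rewrite rmorph_sum; apply: eq_bigr => j _ /=; rewrite evalQZ /= ratr_int.
Qed.

Lemma evalQ_conj_eq x r p q :
  root (minCpoly x) r -> evalQ x p = evalQ x q -> evalQ r p = evalQ r q.
Proof.
have [f [-> _] fP] := minCpolyP x => /rootP fr /eqP.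
rewrite -subr_eq0 -rmorphB => /eqP pqx.
have /dvdpP[h hE] : f %| p - q by rewrite -fP; apply/rootP.
by apply/eqP; rewrite -subr_eq0 -rmorphB hE rmorphM /= [evalQ r f]fr mulr0.
Qed.

Lemma root_minCpoly_evalQ x r p :
  root (minCpoly x) r -> root (minCpoly (evalQ x p)) (evalQ r p).
Proof.
have [f [fE _] _] := minCpolyP (evalQ x p) => xr; rewrite fE; apply/rootP.
rewrite -/(evalQ _ f) -evalQ_comp (evalQ_conj_eq (q := 0) xr) ?rmorph0 //.
by rewrite evalQ_comp; apply/rootP; rewrite -fE root_minCpoly.
Qed.

Lemma Aint_conj x r p :
  root (minCpoly x) r -> evalQ x p \in Aint -> evalQ r p \in Aint.
Proof.
move=> xr; apply: root_monic_Aint (root_minCpoly_evalQ p xr) _.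
exact: minCpoly_monic.
Qed.

Lemma root_monic_int_Aint (p : {poly int}) (x : algC) :
  p \is monic -> root (map_poly intr p) x -> x \in Aint.
Proof.
move=> pm px; apply: (root_monic_Aint px); first exact: monic_map.
by apply/polyOverP => i; rewrite coef_map intr_int.
Qed.

Lemma root_Aint n (x : algC) : (0 < n)%N -> x ^+ n \in Aint -> x \in Aint.
Proof.
move=> n0 xnA; apply: (@root_monic_Aint (minCpoly (x ^+ n) \Po 'X^n)).
- by rewrite /root horner_comp hornerXn; exact: root_minCpoly.
- rewrite monicE lead_coef_comp ?size_polyXn // lead_coefXn expr1n mulr1.
  exact: minCpoly_monic.
- by rewrite polyOver_comp ?rpredX ?polyOverX.
Qed.

Lemma ratr_Aint (a : rat) : ratr a \in Aint -> exists n : int, a = n%:~R.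
Proof.
move=> aA; have /intrP[n an] : (ratr a : algC) \is a Num.int.
  by rewrite Cint_rat_Aint ?Crat_rat.
by exists n; apply: (fmorph_inj (ratr : rat -> algC)); rewrite /= an ratr_int.
Qed.

Lemma minCpoly_eisenstein (p : nat) (f : {poly int}) (x : algC) :
    prime p -> f \is monic -> ~~ (p%:Z ^+ 2 %| f`_0)%Z ->
    (forall i, (i < (size f).-1)%N -> (p %| f`_i)%Z) ->
    root (map_poly intr f) x ->
  minCpoly x = map_poly intr f.
Proof.
move=> p_prime f_monic f0 fp fx.
have fE : map_poly intr f = map_poly ratr (map_poly intr f) :> {poly algC}.
  by rewrite -map_poly_comp; apply: eq_map_poly => i /=; rewrite ratr_int.
have size_f : size f != 1%N.
  apply: contraTneq fx => /eqP/size_poly1P[c _ fc].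
  move: f_monic; rewrite fc monicE lead_coefC => /eqP->.
  by rewrite map_polyC /= root1.
have lead_f : lead_coef f \notin dvdz p.
  by rewrite (monicP f_monic) dvdz1 absz_nat gtn_eqF ?prime_gt1.
have f_irr := eisenstein_crit p_prime size_f lead_f f0 fp.
have [_ fQ_irr] := (irreducible_rat_int f).2 f_irr.
have [g [gE gm] gP] := minCpolyP x.
rewrite fE gE; congr map_poly; apply/eqP; rewrite -eqp_monic ?monic_map //.
apply: fQ_irr; last by rewrite -gP -fE.
by have := size_minCpoly x; rewrite gE size_map_poly; case: (size g) => [|[]].
Qed.

Lemma in_Qgen_ratr x a : in_Qgen x (ratr a).
Proof. by exists a%:P; rewrite -/(evalQ _ _) evalQC. Qed.

Lemma in_Qgen_id x : in_Qgen x x.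
Proof. by exists 'X; rewrite -/(evalQ _ _) evalQX. Qed.

Lemma in_QgenN x y : in_Qgen x y -> in_Qgen x (- y).
Proof. by move=> [p ->]; exists (- p); rewrite -!/(evalQ _ _) rmorphN. Qed.

Lemma in_QgenD x y z : in_Qgen x y -> in_Qgen x z -> in_Qgen x (y + z).
Proof.
by move=> [p ->] [q ->]; exists (p + q); rewrite -!/(evalQ _ _) rmorphD.
Qed.

Lemma in_QgenM x y z : in_Qgen x y -> in_Qgen x z -> in_Qgen x (y * z).
Proof.
by move=> [p ->] [q ->]; exists (p * q); rewrite -!/(evalQ _ _) rmorphM.
Qed.

Lemma in_QgenX x y n : in_Qgen x y -> in_Qgen x (y ^+ n).
Proof. by move=> [p ->]; exists (p ^+ n); rewrite -!/(evalQ _ _) rmorphXn. Qed.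

Lemma in_Qgen_evalQ x y p : in_Qgen x y -> in_Qgen x (evalQ y p).
Proof.
by move=> [q ->]; exists (p \Po q); rewrite -!/(evalQ _ _) evalQ_comp.
Qed.

Lemma in_OK_int x (m : int) : in_OK x m%:~R.
Proof.
by split; [rewrite -ratr_int; exact: in_Qgen_ratr | exact: Aint_int].
Qed.

Lemma in_OK_nat x (n : nat) : in_OK x n%:R.
Proof. exact: in_OK_int x n. Qed.

Lemma in_OKN x y : in_OK x y -> in_OK x (- y).
Proof. by move=> [yQ yA]; split; [exact: in_QgenN | rewrite rpredN]. Qed.

Lemma in_OKD x y z : in_OK x y -> in_OK x z -> in_OK x (y + z).
Proof.
by move=> [yQ yA] [zQ zA]; split; [exact: in_QgenD | exact: rpredD].
Qed.

Lemma in_OKM x y z : in_OK x y -> in_OK x z -> in_OK x (y * z).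
Proof.
by move=> [yQ yA] [zQ zA]; split; [exact: in_QgenM | exact: rpredM].
Qed.

Lemma in_OKX x y n : in_OK x y -> in_OK x (y ^+ n).
Proof. by move=> [yQ yA]; split; [exact: in_QgenX | exact: rpredX]. Qed.

Lemma in_OK_sqr x y : in_Qgen x y -> in_OK x (y ^+ 2) -> in_OK x y.
Proof. by move=> yQ [_ yA]; split=> //; exact: root_Aint yA. Qed.

Section Generators.

Variables (b : algC) (rs : seq algC) (p : {poly rat}).
Hypothesis minCpoly_b : minCpoly b = \prod_(r <- rs) ('X - r%:P).

Let root_b r : root (minCpoly b) r = (r \in rs).
Proof. by rewrite minCpoly_b root_prod_XsubC. Qed.

Lemma same_field_conj_uniq :
  uniq rs -> same_field b (evalQ b p) -> uniq [seq evalQ r p | r <- rs].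
Proof.
move=> rs_uniq [_ [q bE]].
have qpK r : r \in rs -> evalQ (evalQ r p) q = r.
  rewrite -root_b -evalQ_comp => br; rewrite -[RHS]evalQX.
  by apply: (evalQ_conj_eq br); rewrite evalQ_comp evalQX.
by rewrite map_inj_in_uniq // => x y /qpK xE /qpK yE xy; rewrite -xE xy yE.
Qed.

Hypothesis conj_uniq : uniq [seq evalQ r p | r <- rs].

(* The matrix of the powers of [p] modulo the minimal polynomial of [b] is
   invertible: a vector in its kernel is a polynomial of degree less than
   [size rs] vanishing at all the conjugates of [evalQ b p]. *)
Lemma evalQ_generator g :
  exists2 h : {poly rat}, (size h <= size rs)%N &
    evalQ b g = evalQ (evalQ b p) h.
Proof.
have [f [fE f_monic] _] := minCpolyP b.
have fb : evalQ b f = 0 by apply/rootP; rewrite -fE root_minCpoly.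
have size_modp (q : {poly rat}) : (size (q %% f)%R <= size rs)%N.
  rewrite -ltnS -(size_prod_XsubC rs id) -minCpoly_b fE size_map_poly.
  by rewrite ltn_modp monic_neq0.
pose M : 'M[rat]_(size rs) := \matrix_i poly_rV (p ^+ i %% f).
have evalQ_M v : evalQ b (rVpoly (v *m M)) = evalQ (evalQ b p) (rVpoly v).
  rewrite mulmx_sum_row [in RHS](row_sum_delta v) !linear_sum !rmorph_sum.
  apply: eq_bigr => i _; rewrite !linearZ /= !evalQZ rowK rVpoly_delta.
  by rewrite poly_rV_K ?size_modp // evalQ_modp // !rmorphXn /= evalQX.
have M_unit : M \in unitmx.
  rewrite -row_free_unit -kermx_eq0; apply/rowV0P => v /sub_kermxP vM0.
  apply: (can_inj rVpolyK); rewrite linear0; apply: contraTeq conj_uniq => v0.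
  have v_root : all (root (map_poly ratr (rVpoly v))) [seq evalQ r p | r <- rs].
    apply/allP => _ /mapP[r br ->]; rewrite -root_b in br; apply/rootP.
    rewrite -/(evalQ _ _) -evalQ_comp (evalQ_conj_eq (q := 0) br) ?rmorph0 //.
    by rewrite evalQ_comp -evalQ_M vM0 linear0 rmorph0.
  apply/negP => /(max_poly_roots _ v_root).
  rewrite map_poly_eq0 v0 size_map size_map_poly ltnNge size_poly.
  by move=> /(_ isT).
exists (rVpoly (poly_rV (g %% f) *m invmx M)); first by rewrite size_poly.
by rewrite -evalQ_M mulmxKV // poly_rV_K ?size_modp // evalQ_modp.
Qed.

Lemma conj_uniq_same_field : same_field b (evalQ b p).
Proof.
split; first by exists p.
by have [h _ bE] := evalQ_generator 'X; exists h; rewrite -[LHS]evalQX.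
Qed.

Lemma minCpoly_generator :
  minCpoly (evalQ b p) = \prod_(r <- rs) ('X - (evalQ r p)%:P).
Proof.
rewrite -(big_map (evalQ^~ p) xpredT (fun y => 'X - y%:P)).
set ys := map _ _; apply/eqP; rewrite eq_sym.
rewrite -eqp_monic ?monic_prod_XsubC ?minCpoly_monic //.
have ys_dvd : \prod_(y <- ys) ('X - y%:P) %| minCpoly (evalQ b p).
  rewrite uniq_roots_dvdp ?uniq_rootsE //; apply/allP => _ /mapP[r br ->].
  by rewrite root_minCpoly_evalQ ?root_b.
rewrite -dvdp_size_eqp // eqn_leq dvdp_leq ?minCpoly_eq0 //=.
have [h size_h hE] := evalQ_generator (p ^+ size rs).
have [f [-> _] fP] := minCpolyP (evalQ b p).
rewrite size_prod_XsubC size_map size_map_poly.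
have f_dvd : f %| 'X^(size rs) - h.
  rewrite -fP; apply/rootP; rewrite -/(evalQ _ _).
  by rewrite rmorphB rmorphXn /= evalQX -hE rmorphXn subrr.
have size_Xh : size ('X^(size rs) - h) = (size rs).+1.
  by rewrite size_polyDl ?size_polyXn // size_polyN ltnS.
by rewrite -size_Xh dvdp_leq // -size_poly_eq0 size_Xh.
Qed.

End Generators.

(** * Discriminant and integral bases *)

Definition conj_mx n (rs : 'I_n -> algC) (P : 'I_n -> {poly rat}) :
    'M[algC]_n :=
  \matrix_(i, j) evalQ (rs i) (P j).

Lemma conj_mx_int_comb n b (rs : 'I_n -> algC) (P Q : 'I_n -> {poly rat}) :
    (forall i, root (minCpoly b) (rs i)) ->
    (forall j, exists z : 'I_n -> int,
       evalQ b (Q j) = \sum_l (z l)%:~R * evalQ b (P l)) ->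
  exists Z : 'M[int]_n, conj_mx rs Q = conj_mx rs P *m map_mx intr Z.
Proof.
move=> rs_root /fin_all_exists[z zP]; exists (\matrix_(l, j) z j l).
apply/matrixP => i j; rewrite !mxE; under eq_bigr do rewrite !mxE mulrC.
rewrite -evalQ_int_comb; apply: (evalQ_conj_eq (rs_root i)).
by rewrite evalQ_int_comb.
Qed.

Lemma normr_det_intmx_equiv (R : numDomainType) n (A B : 'M[R]_n)
    (Z Z' : 'M[int]_n) :
    A = B *m map_mx intr Z -> B = A *m map_mx intr Z' -> \det A != 0 ->
  `|\det B| = `|\det A|.
Proof.
move=> /(congr1 determinant) detA /(congr1 determinant) detB A0.
rewrite !det_mulmx !det_map_mx in detA detB.
have detZZ' : \det Z * \det Z' = 1.
  apply: (intr_inj (R := R)); apply: (mulfI A0).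
  by rewrite mulr1 rmorphM /= mulrCA -detB mulrC -detA.
have normZ' : `|\det Z'| = 1 :> int.
  have /eqP := congr1 absz detZZ'; rewrite abszM muln_eq1 => /andP[_ /eqP].
  by rewrite -abszE => ->.
by rewrite detB normrM -intr_norm normZ' mulr1.
Qed.

Lemma normr_det_conj_mx_perm n (rs ts : 'I_n -> algC) (P : 'I_n -> {poly rat}) :
    perm_eq (codom rs) (codom ts) ->
  `|\det (conj_mx rs P)| = `|\det (conj_mx ts P)|.
Proof.
rewrite -[codom ts]/(tval [tuple ts i | i < n]) => /tuple_permP[s rsE].
have -> : conj_mx rs P = row_perm s (conj_mx ts P).
  apply/matrixP => i j; rewrite !mxE.
  have := congr1 (fun u => nth 0 u i) rsE.
  rewrite /codom /image_mem (nth_map i) ?size_enum_ord // nth_ord_enum => ->.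
  by rewrite (nth_map i) ?size_enum_ord // nth_ord_enum tnth_mktuple.
by rewrite row_permE det_mulmx det_perm normrM normr_sign mul1r.
Qed.

Lemma abs_disc_integral_basis b D n
    (rs : 'I_n -> algC) (P : 'I_n -> {poly rat}) :
    minCpoly b = \prod_i ('X - (rs i)%:P) ->
    (forall j, evalQ b (P j) \in Aint) ->
    (forall x, in_OK b x ->
       exists z : 'I_n -> int, x = \sum_j (z j)%:~R * evalQ b (P j)) ->
    \det (conj_mx rs P) != 0 ->
  abs_disc b D -> D = `|\det (conj_mx rs P)| ^+ 2.
Proof.
move=> rsE PA Pspan det0 [n' [ts [Q /= [tsE [QA [Qspan [_ ->]]]]]]].
have codomE m (us : 'I_m -> algC) :
    \prod_i ('X - (us i)%:P) = \prod_(u <- codom us) ('X - u%:P).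
  by rewrite /codom big_map big_enum.
have ts_rs : perm_eq (codom ts) (codom rs).
  by apply: prod_XsubC_eq; rewrite -!codomE -tsE.
have nE : n' = n by have := perm_size ts_rs; rewrite !size_codom !card_ord.
subst n'; rewrite -/(conj_mx ts Q).
have ts_root i : root (minCpoly b) (ts i).
  by rewrite tsE codomE root_prod_XsubC codom_f.
have [j|Z PQ] := conj_mx_int_comb (P := Q) (Q := P) ts_root.
  by apply: Qspan; split; [exists (P j) | exact: PA].
have [j|Z' QP] := conj_mx_int_comb (P := P) (Q := Q) ts_root.
  by apply: Pspan; split; [exists (Q j) | exact: QA].
have normE := normr_det_conj_mx_perm P ts_rs.
by rewrite -normE (normr_det_intmx_equiv PQ QP) // -normr_gt0 normE normr_gt0.
Qed.

Lemma det_mx22 (R : comNzRingType) (A : 'M[R]_2) :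
  \det A = A 0 0 * A 1 1 - A 0 1 * A 1 0.
Proof.
rewrite (expand_det_row _ 0) !big_ord_recl big_ord0 /cofactor !det_mx11 !mxE /=.
rewrite expr0 expr1 mul1r addr0 mulN1r mulrN.
by congr (A _ _ * A _ _ - A _ _ * A _ _); apply: val_inj.
Qed.

Lemma det_block_mxN (R : comPzRingType) n (A B : 'M[R]_n) :
  \det (block_mx A B A (- B)) = (- 2) ^+ n * (\det A * \det B).
Proof.
have -> : block_mx A B A (- B) =
    block_mx 1%:M 0 1%:M 1%:M *m block_mx A B 0 (- 2 *: B).
  rewrite mulmx_block !mul1mx !mul0mx !addr0; congr block_mx.
  by rewrite scaleNr scaler_nat mulr2n opprD addrA subrr add0r.
by rewrite det_mulmx det_lblock !det1 !mul1r det_ublock detZ mulrCA.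
Qed.

(** * Mahler measure *)

Definition mahler_factor (x : algC) : algC := Num.max 1 `|x|.

Lemma comparable1_norm (R : numDomainType) (x : R) : (1 >=< `|x|)%O.
Proof. by rewrite real_comparable ?real1 ?normr_real. Qed.

Lemma mahler_factor_ge1 x : 1 <= mahler_factor x.
Proof. by rewrite comparable_le_max ?comparable1_norm ?lexx. Qed.

Lemma mahler_factor_ge0 x : 0 <= mahler_factor x.
Proof. exact: le_trans ler01 (mahler_factor_ge1 x). Qed.

Lemma mahler_factor_ge_norm x : `|x| <= mahler_factor x.
Proof. by rewrite comparable_le_max ?comparable1_norm ?lexx ?orbT. Qed.

Lemma mahler_factor_le x y : 1 <= y -> `|x| <= y -> mahler_factor x <= y.
Proof.
by move=> y1 xy; rewrite comparable_ge_max ?comparable1_norm ?y1.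
Qed.

Lemma prod_mahler_factor (rs : seq algC) :
  \prod_(r <- rs | 1 <= `|r|) `|r| = \prod_(r <- rs) mahler_factor r.
Proof.
rewrite big_mkcond; apply: eq_bigr => r _; rewrite /mahler_factor.
by case: (comparable_leP (comparable1_norm r)).
Qed.

Lemma distr_le_mahler_factor x y :
  `|x - y| <= 2 * (mahler_factor x * mahler_factor y).
Proof.
have [x_ge0 y_ge0] := (mahler_factor_ge0 x, mahler_factor_ge0 y).
rewrite mulr_natl mulr2n (le_trans (ler_normB _ _)) // lerD //.
  apply: le_trans (mahler_factor_ge_norm x) _.
  by rewrite ler_peMr ?mahler_factor_ge1.
apply: le_trans (mahler_factor_ge_norm y) _.
by rewrite ler_peMl ?mahler_factor_ge1.
Qed.

Lemma mahler_factorDB_le (x y e : algC) : 1 <= e -> e <= y -> `|x - y| <= e ->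
  mahler_factor (x + y) * mahler_factor (x - y) <= 3 * y * e.
Proof.
move=> e_ge1 ey xy_le; have y_ge1 := le_trans e_ge1 ey.
have y_ge0 := le_trans ler01 y_ge1.
rewrite ler_pM ?mahler_factor_ge0 ?mahler_factor_le //.
  by rewrite (le_trans y_ge1) // ler_peMl // ler1n.
have -> : x + y = x - y + 2 * y by ring.
rewrite (le_trans (ler_normD _ _)) // [X in _ + X]ger0_norm ?mulr_ge0 //.
have -> : 3 * y = y + 2 * y by ring.
by rewrite lerD2r (le_trans xy_le).
Qed.

Lemma alg_mahler_Aint a m (rs : seq algC) :
    a \in Aint -> minCpoly a = \prod_(r <- rs) ('X - r%:P) ->
  alg_mahler a m <-> m = \prod_(r <- rs) mahler_factor r.
Proof.
move=> aA rsE.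
have lead1 : lead_coef (minCpoly a) = 1 by apply/monicP/minCpoly_monic.
split=> [[_ [[c [c0 [-> [_ c_min]]]] [ts [tsE ->]]]] | ->].
  have c1 : c = 1%N.
    apply/eqP; rewrite eqn_leq c0 andbT leqNgt; apply/negP => c_gt1.
    by have := c_min 1%N c_gt1; rewrite scale1r => /negP[].
  rewrite c1 !scale1r lead1 scale1r in tsE.
  rewrite c1 scale1r lead1 normr1 mul1r prod_mahler_factor.
  by apply/perm_big/prod_XsubC_eq; rewrite -tsE.
exists (minCpoly a); split.
  by exists 1%N; rewrite scale1r; do 2!split=> //; split=> // -[|[|]].
by exists rs; rewrite lead1 scale1r normr1 mul1r prod_mahler_factor.
Qed.

Lemma alg_mahler_generator b m (rs : seq algC) p :
    minCpoly b = \prod_(r <- rs) ('X - r%:P) -> evalQ b p \in Aint ->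
    uniq [seq evalQ r p | r <- rs] ->
  alg_mahler (evalQ b p) m <-> m = \prod_(r <- rs) mahler_factor (evalQ r p).
Proof.
move=> bE pA p_uniq; rewrite -(big_map (evalQ^~ p) xpredT).
by apply: alg_mahler_Aint => //; rewrite (minCpoly_generator bE p_uniq) big_map.
Qed.

(** * The quadratic field of a prime congruent to 1 modulo 4 *)

Definition omega (R : fieldType) (s : R) : R := (1 + s) / 2.

Lemma real_nearest_int (R : archiNumFieldType) (x : R) :
  x \is Num.real -> exists n : int, `|n%:~R - x| <= 2^-1.
Proof.
move=> x_real; exists (Num.floor (x + 2^-1)).
have /real_floor_itv/andP[] : x + 2^-1 \is Num.real by rewrite realD ?realV.
have halfE : 1 = 2^-1 + 2^-1 :> R by field.
rewrite intrD [in X in _ < _ + X]halfE addrA ltrD2r => floor_le /ltW floor_ge.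
rewrite real_ler_norml ?realB ?realz // lerBlDl floor_le andbT.
by rewrite lerNl opprB lerBlDl floor_ge.
Qed.

Lemma omega_round (R : archiNumFieldType) (s u v : R) :
    0 < s -> u \is Num.real -> v \is Num.real ->
  exists m n : int, `|m%:~R + n%:~R * omega s - u| <= 2^-1 + s / 4 /\
                    `|m%:~R + n%:~R * omega (- s) - v| <= 2^-1 + s / 4.
Proof.
move=> s_gt0 u_real v_real; have s_real := gtr0_real s_gt0.
have [n nP] : exists n : int, `|n%:~R - (u - v) / s| <= 2^-1.
  by apply: real_nearest_int; rewrite realM ?realB ?realV.
have [m mP] : exists m : int, `|m%:~R - ((u + v) / 2 - n%:~R / 2)| <= 2^-1.
  by apply: real_nearest_int; rewrite realB ?realM ?realD ?realV ?realz.
pose e := n%:~R - (u - v) / s; pose d := m%:~R - ((u + v) / 2 - n%:~R / 2).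
have e_le : `|e * s / 2| <= s / 4.
  rewrite !normrM normfV (gtr0_norm s_gt0) normr_nat -mulrA.
  have -> : s / 4 = 2^-1 * (s / 2) by field.
  by rewrite ler_wpM2r // divr_ge0 // ltW.
have s0 : s != 0 by rewrite gt_eqF.
exists m, n; split.
  have -> : m%:~R + n%:~R * omega s - u = d + e * s / 2.
    by rewrite /d /e /omega; field.
  by rewrite (le_trans (ler_normD _ _)) // lerD.
have -> : m%:~R + n%:~R * omega (- s) - v = d - e * s / 2.
  by rewrite /d /e /omega; field.
by rewrite (le_trans (ler_normB _ _)) // lerD.
Qed.

Lemma Euclid_dvdzM (p : nat) (a b : int) : prime p ->
  (p %| a * b)%Z = (p %| a)%Z || (p %| b)%Z.
Proof. by move=> p_prime; rewrite !dvdzE abszM Euclid_dvdM. Qed.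

Lemma squarefree_logn n p :
  (0 < n)%N -> squarefree n -> prime p -> (logn p n <= 1)%N.
Proof.
by move=> n0 n_sqf p_prime; rewrite leqNgt -pfactor_dvdn // n_sqf.
Qed.

Lemma squarefree_dvdz (n : nat) (a : int) : (0 < n)%N -> squarefree n ->
  (forall p, prime p -> (p %| n)%N -> (p %| a)%Z) -> (n %| a)%Z.
Proof.
move=> n0 n_sqf pa; rewrite dvdzE /=; apply/dvdn_partP => // p.
rewrite mem_primes => /and3P[p_prime _ pn].
have := pa p p_prime pn; rewrite dvdzE; apply: dvdn_trans.
by rewrite p_part -[X in (_ %| X)%N]expn1 dvdn_exp2l ?squarefree_logn.
Qed.

Lemma prime_squarefree p : prime p -> squarefree p.
Proof.
move=> p_prime l l_prime.
by rewrite mulnn pfactor_dvdn ?prime_gt0 // logn_prime //; case: eqP.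
Qed.

Lemma squarefreeM a b :
  coprime a b -> squarefree a -> squarefree b -> squarefree (a * b).
Proof.
move=> ab a_sqf b_sqf p p_prime; have [pa|pa] := boolP (p %| a)%N.
  have pb : coprime p b by exact: coprime_dvdl ab.
  by rewrite mulnC Gauss_dvdr ?a_sqf // coprimeMl pb.
by rewrite Gauss_dvdr ?b_sqf // coprimeMl prime_coprime ?pa.
Qed.

Section PrimeQuadraticField.

Variables (q c : nat).
Hypotheses (q_prime : prime q) (qE : q = (4 * c + 1)%N).

Let s : algC := sqrtC q%:R.

Let sqr_s : s ^+ 2 = q%:R.
Proof. exact: sqrtCK. Qed.

Let s_neq0 : s != 0.
Proof. by rewrite sqrtC_eq0 pnatr_eq0 -lt0n prime_gt0. Qed.

Let qZ : q%:Z = 4 * c%:Z + 1.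
Proof. by rewrite qE PoszD PoszM. Qed.

Lemma minCpoly_sqrt_prime : minCpoly s = 'X^2 - q%:R%:P.
Proof.
have mapE : map_poly intr ('X^2 - q%:R%:P) = 'X^2 - q%:R%:P :> {poly algC}.
  by rewrite rmorphB /= map_polyXn map_polyC /= rmorph_nat.
rewrite -mapE; apply: (minCpoly_eisenstein q_prime).
- exact: monicXnsubC.
- rewrite !coefE /= sub0r rpredN dvdzE abszX natz /= -[X in (_ %| X)%N]expn1.
  by rewrite dvdn_Pexp2l // prime_gt1.
- rewrite size_XnsubC // => -[|[|i]] //= _; rewrite !coefE ?subr0 //=.
  by rewrite sub0r rpredN natz.
- by rewrite mapE; apply/rootP; rewrite !hornerE sqr_s subrr.
Qed.

Lemma root_minCpoly_sqrt_primeN : root (minCpoly s) (- s).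
Proof.
by rewrite minCpoly_sqrt_prime; apply/rootP; rewrite !hornerE sqrrN sqr_s subrr.
Qed.

Lemma sqrt_prime_irrational : s \notin Crat.
Proof.
apply/negP => /CratP[a sE].
have : evalQ s 'X = evalQ s a%:P by rewrite evalQX evalQC.
move=> /(evalQ_conj_eq root_minCpoly_sqrt_primeN).
rewrite evalQX evalQC -sE => /eqP.
by rewrite eq_sym -addr_eq0 -mulr2n mulrn_eq0 (negPf s_neq0).
Qed.

Lemma in_Qgen_sqrtP x :
  in_Qgen s x -> exists u v : rat, x = ratr u + ratr v * s.
Proof.
move=> [p ->]; exists (even_poly p).[q%:R], (odd_poly p).[q%:R].
by rewrite -/(evalQ s p) evalQ_even_odd sqr_s -!evalQ_ratr ratr_nat.
Qed.

Lemma in_OK_sqrt_prime : in_OK s s.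
Proof.
split; first exact: in_Qgen_id.
by apply: (@root_Aint 2) => //; rewrite sqr_s rpred_nat.
Qed.

Lemma sqr_omega : omega s ^+ 2 = omega s + c%:R.
Proof.
have s2 : s ^+ 2 = 4 * c%:R + 1 by rewrite sqr_s qE natrD natrM.
by rewrite /omega; field: s2.
Qed.

Lemma in_OK_omega : in_OK s (omega s).
Proof.
split.
  have -> : omega s = ratr 2^-1 * (1 + s).
    by rewrite fmorphV /= ratr_nat /omega; field.
  apply: in_QgenM (in_Qgen_ratr _ _) _.
  exact: in_QgenD (in_OK_nat _ 1).1 (in_Qgen_id _).
apply: (@root_monic_int_Aint ('X^2 - ('X + c%:R%:P))).
  rewrite monicE lead_coefDl ?lead_coefXn //.
  by rewrite size_polyN size_XaddC size_polyXn.
rewrite rmorphB rmorphD /= map_polyXn map_polyC map_polyX /= rmorph_nat.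
by apply/rootP; rewrite !hornerE sqr_omega subrr.
Qed.

Lemma in_OK_int_omega (m n : int) : in_OK s (m%:~R + n%:~R * omega s).
Proof.
apply: in_OKD; first exact: in_OK_int.
exact: in_OKM (in_OK_int _ _) in_OK_omega.
Qed.

Lemma int_omega_inj (m n i j : int) :
  m%:~R + n%:~R * omega s = i%:~R + j%:~R * omega s -> m = i /\ n = j.
Proof.
move=> mnij; have [nj|nj] := eqVneq n j.
  split=> //; apply: (intr_inj (R := algC)).
  by apply: (addIr (n%:~R * omega s)); rewrite {2}nj.
case/negP: sqrt_prime_irrational.
have nj0 : n%:~R - j%:~R != 0 :> algC by rewrite subr_eq0 eqr_int.
have -> : s = (2 * (i%:~R - m%:~R) - (n%:~R - j%:~R)) / (n%:~R - j%:~R).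
  apply: (canRL (mulfK nj0)); apply/eqP; rewrite -subr_eq0; apply/eqP.
  have := congr1 (fun x => 2 * (x - (i%:~R + j%:~R * omega s))) mnij.
  by rewrite subrr mulr0 => <-; rewrite /omega; field.
by rewrite !(rpred_div, rpredB, rpredM, rpred_int, rpred_nat).
Qed.

(* Here [a] and [d] are the trace and the norm of [a / 2 + e / (2 q) * s]. *)
Lemma omega_coords_of_norm (a e d : int) :
  q%:Z * (a * a) - e * e = 4 * q%:Z * d ->
  exists m n : int, a = 2 * m + n /\ e = q%:Z * n.
Proof.
move=> norm_eq.
have /dvdzP[n eE] : (q %| e)%Z.
  have : (q %| e * e)%Z by apply/dvdzP; exists (a * a - 4 * d); lia.
  by rewrite Euclid_dvdzM // orbb.
have q0 : q%:Z != 0 by rewrite -lt0n prime_gt0.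
have reduced_eq : a * a - q%:Z * (n * n) = 4 * d.
  by apply: (mulfI q0); rewrite [RHS]mulrCA [RHS]mulrA -norm_eq eE; ring.
have sqr_a : a * a = n * n + 4 * (d + c%:Z * (n * n)).
  by rewrite mulrDr -reduced_eq qZ; ring.
exists ((a - n) %/ 2)%Z, n; split; last by rewrite eE mulrC.
have : odd (`|a| * `|a|) = odd (`|n| * `|n|) by lia.
by rewrite !oddM !andbb; lia.
Qed.

Lemma in_OK_sqrt_primeP x :
  in_OK s x -> exists m n : int, x = m%:~R + n%:~R * omega s.
Proof.
move=> [/in_Qgen_sqrtP[u [v xE]] xA].
pose x' := ratr u - ratr v * s; have x'A : x' \in Aint.
  have evalE r : evalQ r (u%:P + v *: 'X) = ratr u + ratr v * r.
    by rewrite rmorphD /= evalQC evalQZ evalQX.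
  have := Aint_conj (p := u%:P + v *: 'X) root_minCpoly_sqrt_primeN.
  by rewrite !evalE mulrN -xE; apply.
have [a aE] : exists a : int, 2 * u = a%:~R.
  apply: ratr_Aint; suff -> : ratr (2 * u) = x + x' by exact: rpredD.
  by rewrite rmorphM /= ratr_nat xE /x'; ring.
have [e eE] : exists e : int, 2 * q%:R * v = e%:~R.
  apply: ratr_Aint; suff -> : ratr (2 * q%:R * v) = (x - x') * s.
    by apply: rpredM (proj2 in_OK_sqrt_prime); exact: rpredB.
  by rewrite !rmorphM /= !ratr_nat xE /x'; ring: sqr_s.
have [d dE] : exists d : int, u * u - q%:R * (v * v) = d%:~R.
  apply: ratr_Aint.
  suff -> : ratr (u * u - q%:R * (v * v)) = x * x' by exact: rpredM.
  by rewrite rmorphB !rmorphM /= ratr_nat xE /x'; ring: sqr_s.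
have q0 : q%:R != 0 :> rat by rewrite pnatr_eq0 -lt0n prime_gt0.
have [|m [n [am en]]] := @omega_coords_of_norm a e d.
  apply: (intr_inj (R := rat)).
  by rewrite rmorphB !rmorphM /= -aE -eE -dE !rmorph_nat; ring.
have uE : u = m%:~R + n%:~R / 2.
  by apply: (mulfI (_ : 2 != 0)) => //; rewrite aE am rmorphD rmorphM /=; field.
have vE : v = n%:~R / 2.
  by apply: (mulfI (mulf_neq0 (_ : 2 != 0) q0)) => //; rewrite eE en; field.
exists m, n; rewrite xE uE vE rmorphD /= !fmorph_div /= !ratr_int ratr_nat.
by rewrite /omega; field.
Qed.

Lemma dvdz_sqr_int_omega (p : nat) (m n : int) : prime p -> p != q ->
    (p %| m * m + c%:Z * (n * n))%Z -> (p %| 2 * m * n + n * n)%Z ->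
  (p %| m)%Z /\ (p %| n)%Z.
Proof.
move=> p_prime pq dvd_rat dvd_omega.
have pn : (p %| n)%Z.
  have : (p %| q%:Z * (n * (n * n)))%Z.
    have -> : q%:Z * (n * (n * n)) = 4 * n * (m * m + c%:Z * (n * n))
        - (2 * m - n) * (2 * m * n + n * n) by rewrite qZ; ring.
    by rewrite rpredB // dvdz_mull.
  rewrite !Euclid_dvdzM // => /orP[|/or3P[] //].
  by rewrite dvdzE /= dvdn_prime2 // (negPf pq).
split=> //; have : (p %| m * m)%Z.
  have -> : m * m = (m * m + c%:Z * (n * n)) - c%:Z * (n * n) by ring.
  by rewrite rpredB // !dvdz_mull.
by rewrite Euclid_dvdzM // orbb.
Qed.

Section SquarefreeMultiple.

Variable d : nat.
Hypotheses (d_gt0 : (0 < d)%N) (d_sqf : squarefree d) (d_coprime : coprime d q).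

Let d_neq0 : d%:R != 0 :> algC.
Proof. by rewrite pnatr_eq0 -lt0n. Qed.

(* The primes dividing [d] are unramified in [Q(s)], so that [d] divides
   [d * x] as soon as it divides the square of [d * x]. *)
Lemma in_OK_squarefree_sqr x :
  in_Qgen s x -> in_OK s (d%:R * x ^+ 2) -> in_OK s x.
Proof.
move=> xQ dx2O; have sqr_dx : (d%:R * x) ^+ 2 = d%:R * (d%:R * x ^+ 2) by ring.
have dxO : in_OK s (d%:R * x).
  apply: in_OK_sqr; first exact: in_QgenM (in_OK_nat s d).1 xQ.
  by rewrite sqr_dx; exact: in_OKM (in_OK_nat _ _) dx2O.
have [m [n mnE]] := in_OK_sqrt_primeP dxO.
have [i [j ijE]] := in_OK_sqrt_primeP dx2O.
have [ratE omegaE] :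
    m * m + c%:Z * (n * n) = d%:Z * i /\ 2 * m * n + n * n = d%:Z * j.
  apply: int_omega_inj.
  transitivity ((d%:R * x) ^+ 2); first by rewrite mnE; ring: sqr_omega.
  by rewrite sqr_dx ijE; ring.
have dvd_mn p : prime p -> (p %| d)%N -> (p %| m)%Z /\ (p %| n)%Z.
  move=> p_prime pd; apply: dvdz_sqr_int_omega => //.
  - apply: contraTneq d_coprime => <-.
    by rewrite coprime_sym prime_coprime // pd.
  - by rewrite ratE dvdz_mulr.
  - by rewrite omegaE dvdz_mulr.
have /dvdzP[m' mE] : (d %| m)%Z.
  by apply: squarefree_dvdz => // p p_prime /(dvd_mn p p_prime)[].
have /dvdzP[n' nE] : (d %| n)%Z.
  by apply: squarefree_dvdz => // p p_prime /(dvd_mn p p_prime)[].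
suff -> : x = m'%:~R + n'%:~R * omega s by exact: in_OK_int_omega.
by apply: (mulfI d_neq0); rewrite mnE mE nE; ring.
Qed.

(* The two equations say that [d * (m + n * omega) ^+ 2 = s * (i + j * omega)],
   and [s] divides [m + n * omega] exactly when [q] divides [2 * m + n]. *)
Lemma dvdz_sqr_int_omega_sqrt (m n i j : int) :
    d%:Z * (m * m + c%:Z * (n * n)) = 2 * c%:Z * j - i ->
    d%:Z * (2 * m * n + n * n) = 2 * i + j ->
  (q %| 2 * m + n)%Z.
Proof.
move=> ratE omegaE.
have : (q %| d%:Z * ((2 * m + n) * (2 * m + n)))%Z.
  apply/dvdzP; exists (2 * j - d%:Z * (n * n)).
  transitivity (2 * (2 * (2 * c%:Z * j - i) + (2 * i + j))
                - q%:Z * (d%:Z * (n * n))).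
    by rewrite -ratE -omegaE qZ; ring.
  by rewrite qZ; ring.
rewrite !Euclid_dvdzM // orbb => /orP[|//].
by rewrite dvdzE /= -[(q %| d)%N]negbK -prime_coprime // coprime_sym d_coprime.
Qed.

Lemma in_OK_squarefree_sqrt_sqr x :
  in_Qgen s x -> in_OK s (d%:R * s * x ^+ 2) -> in_OK s x.
Proof.
move=> xQ dsx2O.
have sxO : in_OK s (s * x).
  apply: in_OK_squarefree_sqr; first exact: in_QgenM (in_Qgen_id s) xQ.
  have -> : d%:R * (s * x) ^+ 2 = s * (d%:R * s * x ^+ 2) by ring.
  exact: in_OKM in_OK_sqrt_prime dsx2O.
have [m [n mnE]] := in_OK_sqrt_primeP sxO.
have [i [j ijE]] := in_OK_sqrt_primeP dsx2O.
have sE : s = 2 * omega s - 1 by rewrite /omega; field.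
have [ratE omegaE] : d%:Z * (m * m + c%:Z * (n * n)) = 2 * c%:Z * j - i /\
    d%:Z * (2 * m * n + n * n) = 2 * i + j.
  apply: int_omega_inj.
  transitivity (d%:R * (s * x) ^+ 2); first by rewrite mnE; ring: sqr_omega.
  transitivity (s * (d%:R * s * x ^+ 2)); first by ring.
  by rewrite ijE {1}sE; ring: sqr_omega.
have /dvdzP[t tE] := dvdz_sqr_int_omega_sqrt ratE omegaE.
have nE : n = t * (4 * c%:Z + 1) - 2 * m by rewrite -qZ -tE; ring.
suff -> : x = (2 * c%:Z * t - m)%:~R + t%:~R * omega s.
  exact: in_OK_int_omega.
by apply: (mulfI s_neq0); rewrite mnE [X in _ = X * _]sE nE; ring: sqr_omega.
Qed.

End SquarefreeMultiple.

End PrimeQuadraticField.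

(** * The quartic field *)

Definition sqrt5 : algC := sqrtC 5.

Lemma sqr_sqrt5 : sqrt5 ^+ 2 = 5.
Proof. exact: sqrtCK. Qed.

Lemma sqrt5_gt0 : 0 < sqrt5.
Proof. by rewrite sqrtC_gt0. Qed.

Lemma sqrt5_lt3 : sqrt5 < 3.
Proof.
rewrite -(ltr_pXn2r (n := 2)) ?nnegrE ?ltW ?sqrt5_gt0 //.
by rewrite sqr_sqrt5 -natrX ltr_nat.
Qed.

Lemma add5_sqrt5_ge2 : 2 <= 5 + sqrt5.
Proof. by rewrite (@le_trans _ _ 5) ?ler_nat // lerDl ltW ?sqrt5_gt0. Qed.

Lemma sub5_sqrt5_ge2 : 2 <= 5 - sqrt5.
Proof.
have -> : 5 - sqrt5 = 2 + (3 - sqrt5) by ring.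
by rewrite lerDl subr_ge0 ltW ?sqrt5_lt3.
Qed.

Definition beta (k : nat) (s : algC) : algC := sqrtC (k%:R * (5 + s)).

Definition beta_conjs (k : nat) : seq algC :=
  [:: beta k sqrt5; beta k (- sqrt5); - beta k sqrt5; - beta k (- sqrt5)].

Definition omega_poly (k : nat) : {poly rat} := (2 * k%:R)^-1 *: 'X^2 - 2%:P.

Definition OK_basis (k : nat) : seq {poly rat} :=
  [:: 1; omega_poly k; 'X; omega_poly k * 'X].

Definition OK_poly (k : nat) (a b c d : int) : {poly rat} :=
  \sum_(j < 4) ([:: a; b; c; d]`_j)%:~R *: (OK_basis k)`_j.

Section QuarticField.

Variable k : nat.
Hypotheses (k_gt0 : (0 < k)%N) (k_coprime5 : coprime k 5).

Let kC_neq0 : k%:R != 0 :> algC.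
Proof. by rewrite pnatr_eq0 -lt0n. Qed.

Lemma sqr_beta s : beta k s ^+ 2 = k%:R * (5 + s).
Proof. exact: sqrtCK. Qed.

Lemma beta_ge s : 2 <= 5 + s -> 5 / 4 <= beta k s.
Proof.
move=> s_ge; have ks_ge : 2 <= k%:R * (5 + s).
  by rewrite (le_trans s_ge) // ler_peMl ?ler1n // (le_trans _ s_ge).
have ks_ge0 : 0 <= k%:R * (5 + s) by exact: le_trans ks_ge.
rewrite -(ler_pXn2r (n := 2)) ?nnegrE ?sqrtC_ge0 ?divr_ge0 // sqr_beta.
apply: le_trans ks_ge.
by rewrite expr_div_n ler_pdivrMr ?exprn_gt0 // -!natrX -natrM ler_nat.
Qed.

Lemma beta_gt0 s : 2 <= 5 + s -> 0 < beta k s.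
Proof. by move=> /beta_ge; apply: lt_le_trans; rewrite divr_gt0. Qed.

Lemma beta_mul_conj : beta k sqrt5 * beta k (- sqrt5) = 2 * k%:R * sqrt5.
Proof.
have [s_ge0 sN_ge0] : 0 <= sqrt5 /\ 0 <= 5 - sqrt5.
  by split; [exact: ltW sqrt5_gt0 | exact: le_trans sub5_sqrt5_ge2].
rewrite /beta -rootCMl ?mulr_ge0 ?addr_ge0 //.
have -> : k%:R * (5 + sqrt5) * (k%:R * (5 - sqrt5)) = (2 * k%:R * sqrt5) ^+ 2.
  by ring: sqr_sqrt5.
by rewrite sqrCK // !mulr_ge0.
Qed.

Lemma prod_beta_conjs :
  \prod_(r <- beta_conjs k) ('X - r%:P) =
    map_poly intr ('X^4 - (10 * k)%:R *: 'X^2 + (20 * k ^ 2)%:R%:P).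
Proof.
have sqr_beta_polyC s : (beta k s)%:P ^+ 2 = k%:R * (5 + s%:P) :> {poly algC}.
  by rewrite -polyC_exp sqr_beta polyCM polyCD !polyC_natr.
have sqr_s : sqrt5%:P ^+ 2 = 5 :> {poly algC}.
  by rewrite -polyC_exp sqr_sqrt5 polyC_natr.
have := sqr_beta_polyC sqrt5; have := sqr_beta_polyC (- sqrt5).
rewrite !big_cons big_nil mulr1 !polyCN => sqr_b' sqr_b.
rewrite rmorphD rmorphB /= map_polyZ !map_polyXn map_polyC /= !rmorph_nat.
by rewrite -mul_polyC !polyC_natr; ring: sqr_b sqr_b' sqr_s.
Qed.

Lemma minCpoly_beta :
  minCpoly (beta k sqrt5) = \prod_(r <- beta_conjs k) ('X - r%:P).
Proof.
rewrite prod_beta_conjs; set f := (X in map_poly _ X).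
have size_f : size f = 5.
  have intC_inj : injective (intr : int -> algC) by exact: intr_inj.
  rewrite -(size_map_inj_poly intC_inj) ?rmorph0 //.
  by rewrite -prod_beta_conjs size_prod_XsubC.
apply: (@minCpoly_eisenstein 5) => //.
- by rewrite monicE lead_coefE size_f !coefE /= mulr0 subr0 addr0.
- rewrite !coefE /= mulr0 subr0 add0r natz dvdzE abszX /=.
  rewrite -[(20 * _)%N]/(5 * 4 * k ^ 2)%N -mulnA -mulnn dvdn_pmul2l //.
  by rewrite Gauss_dvdr // -prime_coprime // coprimeXr // coprime_sym.
- rewrite size_f => -[|[|[|[|i]]]] //= _; rewrite !coefE /= ?mulr0 ?mulr1.
  + by rewrite subr0 add0r natz dvdzE /= dvdn_mulr.
  + by [].
  + by rewrite sub0r addr0 rpredN natz dvdzE /= dvdn_mulr.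
  + by [].
- by rewrite -prod_beta_conjs root_prod_XsubC mem_head.
Qed.

Lemma evalQ_omega_poly s r :
  r ^+ 2 = k%:R * (5 + s) -> evalQ r (omega_poly k) = omega s.
Proof.
move=> r2; rewrite rmorphB /= evalQZ rmorphXn /= evalQX r2 evalQC.
by rewrite fmorphV rmorphM /= !ratr_nat /omega; field.
Qed.

Lemma evalQ_OK_basis s r j : r ^+ 2 = k%:R * (5 + s) ->
  evalQ r (OK_basis k)`_j = [:: 1; omega s; r; omega s * r]`_j.
Proof.
move=> r2; case: j => [|[|[|[|j]]]] /=; rewrite ?nth_nil ?rmorph0 ?rmorph1 //.
- exact: evalQ_omega_poly.
- exact: evalQX.
- by rewrite rmorphM /= evalQX (evalQ_omega_poly r2).
Qed.

Lemma evalQ_OK_poly s r a b c d : r ^+ 2 = k%:R * (5 + s) ->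
  evalQ r (OK_poly k a b c d) =
    (a%:~R + b%:~R * omega s) + (c%:~R + d%:~R * omega s) * r.
Proof.
move=> r2; rewrite evalQ_int_comb !big_ord_recl big_ord0.
by rewrite !(evalQ_OK_basis _ r2) /=; ring.
Qed.

Lemma Aint_beta : beta k sqrt5 \in Aint.
Proof.
apply: (@root_Aint 2) => //; rewrite sqr_beta.
by rewrite rpredM ?rpredD ?rpred_nat // (in_OK_sqrt_prime 5).2.
Qed.

Lemma in_OK_OK_basis j :
  in_OK (beta k sqrt5) (evalQ (beta k sqrt5) (OK_basis k)`_j).
Proof.
split; first by exists (OK_basis k)`_j.
have omegaA : omega sqrt5 \in Aint := (@in_OK_omega 5 1 erefl).2.
rewrite (evalQ_OK_basis _ (sqr_beta _)); case: j => [|[|[|[|j]]]] //=.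
- exact: Aint_beta.
- exact: rpredM omegaA Aint_beta.
- by rewrite nth_nil Aint0.
Qed.

Lemma in_OK_OK_poly a b c d :
  in_OK (beta k sqrt5) (evalQ (beta k sqrt5) (OK_poly k a b c d)).
Proof.
split; first by exists (OK_poly k a b c d).
rewrite evalQ_int_comb; apply: rpred_sum => j _.
by apply: rpredM (Aint_int _) _; case: (in_OK_OK_basis j).
Qed.

(* Ordering the conjugates as beta, beta', - beta, - beta' gives the matrix
   two equal left blocks and two opposite right blocks. *)
Lemma det_OK_basis :
  \det (conj_mx (fun i : 'I_4 => (beta_conjs k)`_i)
                (fun j => (OK_basis k)`_j)) = 40 * k%:R * sqrt5.
Proof.
set M : 'M_(2 + 2) := conj_mx _ _; pose s i := [:: sqrt5; - sqrt5]`_i.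
pose V : 'M_2 := \matrix_(i, j) omega (s i) ^+ j.
pose W : 'M_2 := \matrix_(i, j) (beta k (s i) * omega (s i) ^+ j).
have conjE (i : 'I_2) : (beta_conjs k)`_i = beta k (s i) /\
    (beta_conjs k)`_(2 + i) = - beta k (s i) by case: i => [[|[|//]] ?].
have basisE i r (j : 'I_2) : r ^+ 2 = k%:R * (5 + s i) ->
    evalQ r (OK_basis k)`_j = omega (s i) ^+ j /\
    evalQ r (OK_basis k)`_(2 + j) = r * omega (s i) ^+ j.
  move=> r2; rewrite !(evalQ_OK_basis _ r2).
  by case: j => [[|[|//]] ?] /=; rewrite ?mulr1 // mulrC.
have -> : M = block_mx V W V (- W).
  rewrite -[M]submxK; congr block_mx; apply/matrixP => i j; rewrite !mxE.
  - by rewrite (conjE i).1 (basisE i _ j _).1 ?sqr_beta.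
  - by rewrite (conjE i).1 (basisE i _ j _).2 ?sqr_beta.
  - by rewrite (conjE i).2 (basisE i _ j _).1 ?sqrrN ?sqr_beta.
  - by rewrite (conjE i).2 (basisE i _ j _).2 ?mulNr ?sqrrN ?sqr_beta.
rewrite (det_block_mxN V W) !det_mx22 !mxE /s /=.
have -> : 40 * k%:R * sqrt5 = 4 * 5 * (beta k sqrt5 * beta k (- sqrt5)).
  by rewrite beta_mul_conj; ring.
by rewrite /omega; field: sqr_sqrt5.
Qed.

Lemma int_sqrt5_add_conj_neq (n : int) r r' :
    r ^+ 2 = k%:R * (5 + sqrt5) -> r' ^+ 2 = k%:R * (5 - sqrt5) ->
  n%:~R * sqrt5 + r != r'.
Proof.
move=> r2 r'2; apply/eqP => r'E.
have mulE : r * r' = (10 * k%:R - 5 * n%:~R ^+ 2) / 2.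
  have : (r' - r) ^+ 2 = 5 * n%:~R ^+ 2 by rewrite -r'E; ring: sqr_sqrt5.
  by rewrite sqrrB r2 r'2 => <-; field.
have mulQ : r * r' \in Crat.
  by rewrite mulE !(rpred_div, rpredB, rpredM, rpredX, rpred_int, rpred_nat).
have k2_neq0 : 2 * k%:R != 0 :> algC by rewrite mulf_neq0 ?kC_neq0 ?pnatr_eq0.
have k2Q : (2 * k%:R)^-1 \in Crat by rewrite !(rpredV, rpredM, rpred_nat).
have /negP irr := @sqrt_prime_irrational 5 isT.
have : (r * r') ^+ 2 == (2 * k%:R * sqrt5) ^+ 2.
  by rewrite exprMn r2 r'2; apply/eqP; ring: sqr_sqrt5.
rewrite eqf_sqr => /orP[] /eqP mul_sqrt5; apply: irr.
  by rewrite -/sqrt5 -(mulKf k2_neq0 sqrt5) -mul_sqrt5 rpredM.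
rewrite -/sqrt5 -(mulKf k2_neq0 sqrt5) -[_ * sqrt5]opprK -mul_sqrt5.
by rewrite rpredM ?rpredN.
Qed.

Lemma beta_translate_conjs (m n : int) :
  let x s := m%:~R + n%:~R * omega s in
  [seq evalQ r (OK_poly k m n 1 0) | r <- beta_conjs k] =
    [:: x sqrt5 + beta k sqrt5; x (- sqrt5) + beta k (- sqrt5);
        x sqrt5 - beta k sqrt5; x (- sqrt5) - beta k (- sqrt5)].
Proof.
have polyE s r : r ^+ 2 = k%:R * (5 + s) ->
    evalQ r (OK_poly k m n 1 0) = m%:~R + n%:~R * omega s + r.
  by move=> /evalQ_OK_poly->; rewrite mul0r addr0 mul1r.
by congr [:: _; _; _; _]; apply: polyE; rewrite ?sqrrN sqr_beta.
Qed.

Lemma beta_translate_conjs_uniq (m n : int) :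
  uniq [seq evalQ r (OK_poly k m n 1 0) | r <- beta_conjs k].
Proof.
rewrite beta_translate_conjs; set x := m%:~R + _; set x' := m%:~R + _.
have subE r : x + r - x' = n%:~R * sqrt5 + r.
  by rewrite /x /x' /omega; field.
have neq r r' : r ^+ 2 = beta k sqrt5 ^+ 2 -> r' ^+ 2 = beta k (- sqrt5) ^+ 2 ->
    x + r != x' + r'.
  rewrite !sqr_beta => r2 r'2; rewrite -subr_eq0 opprD addrA subE subr_eq0.
  exact: int_sqrt5_add_conj_neq r2 r'2.
have neqN y b : 0 < b -> y + b != y - b :> algC.
  by move=> b_gt0; rewrite (inj_eq (addrI y)) -addr_eq0 gt_eqF ?addr_gt0.
have [b_gt0 b'_gt0] := (beta_gt0 add5_sqrt5_ge2, beta_gt0 sub5_sqrt5_ge2).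
rewrite /= !inE !negb_or !neqN // !andbT /= (eq_sym (x' + _)).
by rewrite !neq ?sqrrN.
Qed.

Lemma beta_conjs_uniq : uniq (beta_conjs k).
Proof.
have := beta_translate_conjs_uniq 0 0; rewrite beta_translate_conjs.
by rewrite !mul0r !addr0 !add0r.
Qed.

Lemma prod_mahler_factor_OK_poly_ge a b c d (p := OK_poly k a b c d) :
    uniq [seq evalQ r p | r <- beta_conjs k] ->
  2 * k%:R * sqrt5 <= \prod_(r <- beta_conjs k) mahler_factor (evalQ r p).
Proof.
rewrite /= !inE !negb_or => /and4P[/and3P[_ neq _] /andP[_ neq'] _ _].
have diffE s : evalQ (beta k s) p - evalQ (- beta k s) p =
    2 * (c%:~R + d%:~R * omega s) * beta k s.
  by rewrite !(@evalQ_OK_poly s) ?sqrrN ?sqr_beta //; ring.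
move: (diffE sqrt5) (diffE (- sqrt5)); rewrite !big_cons big_nil mulr1.
set x := evalQ (beta k sqrt5) p; set y := evalQ (- beta k sqrt5) p.
set x' := evalQ (beta k (- sqrt5)) p; set y' := evalQ (- beta k (- sqrt5)) p.
move=> xyE xyE'; pose N := c * c + c * d - d * d.
have normE : (x - y) * (x' - y') = N%:~R * (8 * k%:R * sqrt5).
  by rewrite xyE xyE' mulrACA beta_mul_conj /N /omega; field: sqr_sqrt5.
have N_ge1 : 1 <= `|N%:~R : algC|.
  rewrite norm_intr_ge1 ?intr_int // intr_eq0.
  apply: contra_eq_neq normE => ->.
  by rewrite mul0r mulf_neq0 // subr_eq0.
rewrite -(ler_pM2l (_ : 0 < 4)) //; set lhs := 4 * _; set rhs := 4 * _.
have -> : lhs = 1 * (8 * k%:R * sqrt5) by rewrite /lhs; ring.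
have -> : rhs = 2 * (mahler_factor x * mahler_factor y) *
    (2 * (mahler_factor x' * mahler_factor y')) by rewrite /rhs; ring.
have [xy_le xy'_le] :=
  (distr_le_mahler_factor x y, distr_le_mahler_factor x' y').
apply: le_trans (ler_pM _ _ xy_le xy'_le) => //.
have ks_ge0 : 0 <= 8 * k%:R * sqrt5 by rewrite !mulr_ge0 // ltW ?sqrt5_gt0.
by rewrite -normrM normE normrM [X in _ <= _ * X]ger0_norm // ler_wpM2r.
Qed.

Lemma prod_mahler_factor_translate_le (m n : int) :
    `|m%:~R + n%:~R * omega sqrt5 - beta k sqrt5| <= 5 / 4 ->
    `|m%:~R + n%:~R * omega (- sqrt5) - beta k (- sqrt5)| <= 5 / 4 ->
  \prod_(r <- beta_conjs k) mahler_factor (evalQ r (OK_poly k m n 1 0))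
    <= 40 * k%:R * sqrt5.
Proof.
have e_ge1 : 1 <= 5 / 4 :> algC by rewrite ler_pdivlMr // mul1r ler_nat.
have [ge2 ge2'] := (add5_sqrt5_ge2, sub5_sqrt5_ge2).
rewrite -(big_map (evalQ^~ _) xpredT) beta_translate_conjs.
rewrite !big_cons big_nil mulr1 mulrA mulrACA.
set x := m%:~R + _; set x' := m%:~R + _ => dist dist'.
set b := beta k sqrt5 in dist *; set b' := beta k (- sqrt5) in dist' *.
apply: (@le_trans _ _ (3 * b * (5 / 4) * (3 * b' * (5 / 4)))).
  by rewrite ler_pM ?mulr_ge0 ?mahler_factor_ge0 ?mahler_factorDB_le ?beta_ge.
have -> : 3 * b * (5 / 4) * (3 * b' * (5 / 4)) = 225 / 8 * (k%:R * sqrt5).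
  by rewrite /b /b'; field: beta_mul_conj.
rewrite -[leRHS]mulrA ler_wpM2r ?mulr_ge0 ?(ltW sqrt5_gt0) //.
by rewrite ler_pdivrMr // -natrM ler_nat.
Qed.

Lemma exists_small_alg_mahler : exists a m,
  [/\ in_OK (beta k sqrt5) a, same_field (beta k sqrt5) a, alg_mahler a m
    & m <= 40 * k%:R * sqrt5].
Proof.
have [b_gt0 b'_gt0] := (beta_gt0 add5_sqrt5_ge2, beta_gt0 sub5_sqrt5_ge2).
have [m [n [dist dist']]] :=
  omega_round sqrt5_gt0 (gtr0_real b_gt0) (gtr0_real b'_gt0).
have radius_le : 2^-1 + sqrt5 / 4 <= 5 / 4.
  have -> : 5 / 4 = 2^-1 + 3 / 4 :> algC by field.
  by rewrite lerD2l ler_pM2r ?invr_gt0 // ltW ?sqrt5_lt3.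
have aO := in_OK_OK_poly m n 1 0; have a_uniq := beta_translate_conjs_uniq m n.
exists (evalQ (beta k sqrt5) (OK_poly k m n 1 0)).
exists (\prod_(r <- beta_conjs k) mahler_factor (evalQ r (OK_poly k m n 1 0))).
split=> //.
- exact: conj_uniq_same_field minCpoly_beta a_uniq.
- exact/(alg_mahler_generator _ minCpoly_beta aO.2 a_uniq).
- by apply: prod_mahler_factor_translate_le; exact: le_trans radius_le.
Qed.

Hypotheses (k_odd : odd k) (k_sqf : squarefree k).

(* [beta ^+ 2 = 2 * k * sqrt5 * omega], where [omega] is a unit of inverse
   [omega - 1]. *)
Lemma in_OK_mul_sqr_beta x : in_Qgen sqrt5 x ->
  in_OK sqrt5 (x ^+ 2 * beta k sqrt5 ^+ 2) -> in_OK sqrt5 x.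
Proof.
move=> xQ xbO; have coprime2k : coprime 2 k by rewrite coprime2n.
apply: (@in_OK_squarefree_sqrt_sqr 5 1 _ _ (2 * k)) => //.
- by rewrite muln_gt0.
- by apply: squarefreeM => //; exact: prime_squarefree.
- by rewrite coprimeMl.
have -> : (2 * k)%:R * sqrt5 * x ^+ 2 =
    x ^+ 2 * beta k sqrt5 ^+ 2 * (omega sqrt5 - 1).
  by rewrite sqr_beta /omega; field: sqr_sqrt5.
apply: in_OKM xbO _; apply: in_OKD; first exact: (@in_OK_omega 5 1 erefl).
by apply: in_OKN; exact: in_OK_nat _ 1%N.
Qed.

Lemma in_Qgen_sqr_beta : in_Qgen sqrt5 (beta k sqrt5 ^+ 2).
Proof.
rewrite sqr_beta; apply: in_QgenM (in_OK_nat _ k).1 _.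
exact: in_QgenD (in_OK_nat _ 5).1 (in_Qgen_id _).
Qed.

Lemma in_OK_relative_coords x y :
    in_Qgen sqrt5 x -> in_Qgen sqrt5 y ->
    x + y * beta k sqrt5 \in Aint -> x - y * beta k sqrt5 \in Aint ->
  in_OK sqrt5 x /\ in_OK sqrt5 y.
Proof.
set b := beta k sqrt5 => xQ yQ addA subA; have b2Q := in_Qgen_sqr_beta.
have normO : in_OK sqrt5 (x ^+ 2 - y ^+ 2 * b ^+ 2).
  split.
    apply: in_QgenD; first exact: in_QgenX.
    by apply/in_QgenN/in_QgenM => //; exact: in_QgenX.
  have -> : x ^+ 2 - y ^+ 2 * b ^+ 2 = (x + y * b) * (x - y * b) by ring.
  exact: rpredM.
have double_yO : in_OK sqrt5 (2 * y).
  have double_yQ : in_Qgen sqrt5 (2 * y).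
    exact: in_QgenM (in_OK_nat _ 2).1 yQ.
  apply: in_OK_mul_sqr_beta => //.
  split; first by apply: in_QgenM => //; exact: in_QgenX.
  have -> : (2 * y) ^+ 2 * b ^+ 2 = ((x + y * b) - (x - y * b)) ^+ 2 by ring.
  by rewrite rpredX // rpredB.
have xO : in_OK sqrt5 x.
  apply: (@in_OK_squarefree_sqr 5 1 _ _ 2) => //; first exact: prime_squarefree.
  have -> : 2 * x ^+ 2 = 2 * (x ^+ 2 - y ^+ 2 * b ^+ 2)
      + (2 * y) ^+ 2 * (k%:R * (sqrt5 * omega sqrt5)).
    by rewrite sqr_beta /omega; field: sqr_sqrt5.
  apply: in_OKD; first exact: in_OKM (in_OK_nat _ 2) _.
  apply: in_OKM; first exact: in_OKX.
  apply: in_OKM (in_OK_nat _ _) _.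
  exact: in_OKM (in_OK_sqrt_prime 5) (@in_OK_omega 5 1 erefl).
split=> //; apply: in_OK_mul_sqr_beta => //; rewrite -/b.
have -> : y ^+ 2 * b ^+ 2 = x ^+ 2 - (x ^+ 2 - y ^+ 2 * b ^+ 2) by ring.
by apply: in_OKD; [exact: in_OKX | exact: in_OKN].
Qed.

Lemma in_OK_betaP x : in_OK (beta k sqrt5) x ->
  exists a b c d : int, x = evalQ (beta k sqrt5) (OK_poly k a b c d).
Proof.
move=> [[p ->] pA]; rewrite -/(evalQ _ p) in pA *.
have conjA : evalQ (- beta k sqrt5) p \in Aint.
  apply: Aint_conj pA; rewrite minCpoly_beta root_prod_XsubC.
  by rewrite !inE eqxx !orbT.
rewrite !(evalQ_even_odd _ p) sqrrN mulrN in pA conjA *.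
have evalQ_sqrQ f : in_Qgen sqrt5 (evalQ (beta k sqrt5 ^+ 2) f).
  by apply: in_Qgen_evalQ; exact: in_Qgen_sqr_beta.
have [] := in_OK_relative_coords (evalQ_sqrQ _) (evalQ_sqrQ _) pA conjA.
move=> /(@in_OK_sqrt_primeP 5 1 isT erefl)[a [b ->]].
move=> /(@in_OK_sqrt_primeP 5 1 isT erefl)[c [d ->]].
by exists a, b, c, d; rewrite (evalQ_OK_poly _ _ _ _ (sqr_beta _)).
Qed.

Lemma sqrt_abs_disc D :
  abs_disc (beta k sqrt5) D -> sqrtC D = 40 * k%:R * sqrt5.
Proof.
move=> discD; have s_ge0 := ltW sqrt5_gt0.
rewrite (abs_disc_integral_basis (rs := fun i : 'I_4 => (beta_conjs k)`_i)
  (P := fun j => (OK_basis k)`_j) _ _ _ _ discD).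
- by rewrite det_OK_basis ger0_norm ?mulr_ge0 // sqrCK ?mulr_ge0.
- by rewrite minCpoly_beta (big_nth 0) big_mkord.
- by move=> j; exact: (in_OK_OK_basis j).2.
- move=> x /in_OK_betaP[a [b [c [d ->]]]].
  by exists (fun j => [:: a; b; c; d]`_j); rewrite evalQ_int_comb.
- by rewrite det_OK_basis !mulf_neq0 // gt_eqF // sqrt5_gt0.
Qed.

Lemma alg_mahler_ge a m :
    in_OK (beta k sqrt5) a -> same_field (beta k sqrt5) a -> alg_mahler a m ->
  2 * k%:R * sqrt5 <= m.
Proof.
move=> aO; have [u [v [w [z aE]]]] := in_OK_betaP aO.
move: aO; rewrite {}aE => -[_ aA].
move=> /(same_field_conj_uniq minCpoly_beta beta_conjs_uniq) a_uniq.
move=> /(alg_mahler_generator _ minCpoly_beta aA a_uniq)->.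
exact: prod_mahler_factor_OK_poly_ge.
Qed.

End QuarticField.

Theorem theorem5p3 (k : nat) :
  (1 <= k)%N -> odd k -> squarefree k -> coprime k 5 ->
  forall D m : algC,
    abs_disc (sqrtC (k%:R * (5 + sqrtC 5))) D ->
    is_mahler_OK (sqrtC (k%:R * (5 + sqrtC 5))) m ->
    (1 / 1920%:R) * sqrtC D <= m /\ m <= sqrtC D.
Proof.
move=> k_gt0 k_odd k_sqf k_coprime5 D m.
rewrite -/sqrt5 -/(beta k sqrt5) => discD [[a [aO [aK am]]] m_min].
rewrite (sqrt_abs_disc k_gt0 k_coprime5 k_odd k_sqf discD); split.
  apply: le_trans (alg_mahler_ge k_gt0 k_coprime5 k_odd k_sqf aO aK am).
  rewrite !mulrA ler_wpM2r ?(ltW sqrt5_gt0) // ler_wpM2r //.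
  by rewrite mul1r ler_pdivrMl ?ltr0n // -natrM ler_nat.
have [b [mb [bO bK bm]]] := exists_small_alg_mahler k_gt0 k_coprime5.
exact: le_trans (m_min _ _ bO bK bm).
Qed.
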